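(* For any connected graph $G$ of order $n \geq 2$ and any integer $p$ with $1 \leq p < n$, $$\left\lceil \frac{n+p}{2} \right\rceil \leq \tilde{\gamma}_{c}(M(G + \overline{K_p})) \leq n.$$
   Context: All graphs are non-empty, finite, undirected and simple. The order of a graph is its number of vertices. $\overline{K_p}$ is the edgeless graph on $p$ vertices, and $G + \overline{K_p}$ is the join: the disjoint union of $G$ and $\overline{K_p}$ together with all edges between $V(G)$ and $V(\overline{K_p})$. A dominating set of a graph $H$ is a set $S \subseteq V(H)$ such that $N_H[v] \cap S \neq \emptyset$ for every $v \in V(H)$, where $N_H[v]$ is the closed neighborhood of $v$. A dominating set $S$ of $H$ is an outer-connected dominating set if the graph $H - S$ (obtained by deleting the vertices in $S$) is connected. The outer-connected domination number $\tilde{\gamma}_c(H)$ is the minimum cardinality of an outer-connected dominating set of $H$. The middle graph $M(G)$ of a graph $G$ is the graph with vertex set $V(G) \cup E(G)$ (disjoint union), in which two vertices $x,y$ are adjacent if and only if either $x,y \in E(G)$ are distinct edges sharing an endpoint in $G$, or one of them is a vertex of $G$ and the other is an edge of $G$ incident with it. *)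

(* Defs.v *)
From HB Require Import structures.
From mathcomp Require Import all_boot.

Set Implicit Arguments.
Unset Strict Implicit.
Unset Printing Implicit Defensive.

Record sgraph := SGraph {
  svertex :> finType;
  sedge : rel svertex;
  sedge_sym : symmetric sedge;
  sedge_irr : irreflexive sedge }.

Arguments sedge {_}.

Definition edges (G : sgraph) : {set {set G}} :=
  [set e | [exists x : G, exists y : G, sedge x y && (e == [set x; y])]].

(* The null graph does not count as connected. *)
Definition connected_graph (G : sgraph) : bool :=
  (0 < #|G|) && [forall x : G, forall y : G, connect sedge x y].

Section Induced.
Variables (G : sgraph) (A : {set G}).

Definition induced_rel : rel {x : G | x \in A} :=
  fun x y => sedge (val x) (val y).

Fact induced_sym : symmetric induced_rel.
Proof. by move=> x y; rewrite /induced_rel sedge_sym. Qed.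

Fact induced_irr : irreflexive induced_rel.
Proof. by move=> x; rewrite /induced_rel sedge_irr. Qed.

Definition induced : sgraph := SGraph induced_sym induced_irr.
End Induced.

Section Edgeless.
Variable p : nat.

Definition edgeless_rel : rel 'I_p := fun _ _ => false.

Fact edgeless_sym : symmetric edgeless_rel. Proof. by []. Qed.

Fact edgeless_irr : irreflexive edgeless_rel. Proof. by []. Qed.

Definition edgeless : sgraph := SGraph edgeless_sym edgeless_irr.
End Edgeless.

Section Join.
Variables G H : sgraph.

Definition join_rel : rel (G + H)%type := fun a b =>
  match a, b with
  | inl x, inl y => sedge x y
  | inr x, inr y => sedge x y
  | _, _ => true
  end.

Fact join_sym : symmetric join_rel.
Proof. by case=> x [] y //=; rewrite sedge_sym. Qed.

Fact join_irr : irreflexive join_rel.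
Proof. by case=> x /=; rewrite sedge_irr. Qed.

Definition join : sgraph := SGraph join_sym join_irr.
End Join.

Section Middle.
Variable G : sgraph.

Definition middle_rel : rel (G + {e : {set G} | e \in edges G})%type :=
  fun a b =>
  match a, b with
  | inl _, inl _ => false
  | inl v, inr e => v \in val e
  | inr e, inl v => v \in val e
  | inr e, inr f => (e != f) && (val e :&: val f != set0)
  end.

Fact middle_sym : symmetric middle_rel.
Proof. by case=> x [] y //=; rewrite eq_sym setIC. Qed.

Fact middle_irr : irreflexive middle_rel.
Proof. by case=> x //=; rewrite eqxx. Qed.

Definition middle : sgraph := SGraph middle_sym middle_irr.
End Middle.

Section OuterConnectedDomination.
Variable H : sgraph.

Definition cl_neigh (v : H) : {set H} := [set u | (u == v) || sedge v u].

Definition dominating (S : {set H}) : bool :=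
  [forall v : H, cl_neigh v :&: S != set0].

Definition oc_dominating (S : {set H}) : bool :=
  dominating S && connected_graph (induced (~: S)).

(* The default value #|H| of the minimum matters only when there is no
   outer-connected dominating set; by oc_dominating_ex, this never happens in
   a graph with at least one edge. *)
Definition oc_dom_number : nat :=
  \big[minn/#|H|]_(S : {set H} | oc_dominating S) #|S|.

Lemma oc_dom_number_min (S : {set H}) :
  oc_dominating S -> oc_dom_number <= #|S|.
Proof.
move=> ocS; rewrite /oc_dom_number; have := mem_index_enum S.
elim: (index_enum _) => // T r IHr; rewrite in_cons big_cons.
case/predU1P => [<-|/IHr le_r]; first by rewrite ocS geq_minl.
by case: ifP => // _; rewrite geq_min le_r orbT.
Qed.

Lemma oc_dom_number_attained (S0 : {set H}) : oc_dominating S0 ->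
  exists2 S : {set H}, oc_dominating S & #|S| = oc_dom_number.
Proof.
move=> oc0; case: (arg_minnP (fun S : {set H} => #|S|) oc0) => S ocS minS.
exists S => //; apply/eqP; rewrite eqn_leq oc_dom_number_min // andbT.
rewrite /oc_dom_number; elim/big_ind: _ => [|a b ha hb|T ocT].
- exact: max_card.
- by rewrite leq_min ha.
- exact: minS.
Qed.

Lemma oc_dominating_ex (x y : H) : sedge x y -> oc_dominating (~: [set x]).
Proof.
move=> xy; apply/andP; split.
  apply/forallP => v; apply/set0Pn; have [->|nvx] := eqVneq v x.
    exists y; rewrite !inE xy orbT /=; apply: contraTneq xy => ->.
    by rewrite sedge_irr.
  by exists v; rewrite !inE eqxx.
have xin : x \in ~: ~: [set x] by rewrite setCK set11.
apply/andP; split; first by apply/card_gt0P; exists (exist _ x xin).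
apply/forallP=> a; apply/forallP=> b; suff -> : a = b by exact: connect0.
have eqx (z : {z : H | z \in ~: ~: [set x]}) : val z = x.
  by case: z => z /= zx; apply/set1P; rewrite -(setCK [set x]).
by apply: val_inj; rewrite !eqx.
Qed.
End OuterConnectedDomination.

(* Main.v *)
Require Import Defs.
From mathcomp Require Import all_boot.

Set Implicit Arguments.
Unset Strict Implicit.
Unset Printing Implicit Defensive.

(** Lower bound.  In a middle graph, a vertex [v] of the original graph [H] can
    only be dominated by itself or by an edge incident with it.  One element of
    a dominating set thus takes care of at most two vertices of [H], whence
    [#|H| <= 2 * #|S|] ([card_le_dominating_middle]).

    Upper bound.  Write [w_0, ..., w_(p-1)] for the added vertices.  As
    [p < #|G|], there are a vertex [v0] of [G] and a map [f] from [G] to the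
    added vertices that is already surjective on [G] minus [v0].  Let [S]
    consist of [v0] and of the edges [v w_(f v)] for [v] other than [v0]: it has
    at most [n] elements.  It dominates, since every vertex of the join is [v0]
    or an end of a chosen edge, and so every edge of the join meets an element
    of [S] at each of its ends.  What remains after deleting [S] is connected: all edges of [G] and
    all edges [v0 w_j] survive, every surviving edge of the join has an end in
    [G] (there is no edge between two added vertices), and walking along edges
    of [G] links any two of these ([connect_middle_edges]), as well as the
    surviving vertices of [G]; finally each [w_j] lies on the edge [v0 w_j].

    Keeping [v0] itself in [S], instead of an edge at [v0], is what makes the
    case [p = 1] work: deleting every edge between [G] and a single added
    vertex would isolate the latter. *)

(** * Middle graphs *)

Lemma edges_pair (H : sgraph) (x y : H) :
  sedge x y -> [set x; y] \in edges H.
Proof.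
by move=> xy; rewrite inE; apply/existsP; exists x; apply/existsP; exists y;
  rewrite xy eqxx.
Qed.

Lemma edgesP (H : sgraph) (e : {set H}) :
  reflect (exists x y : H, sedge x y /\ e = [set x; y]) (e \in edges H).
Proof.
rewrite inE; apply: (iffP existsP) => [[x /existsP[y /andP[xy /eqP->]]]|].
  by exists x, y.
by case=> x [y [xy ->]]; have := edges_pair xy; rewrite inE => /existsP.
Qed.

Definition middle_edge (H : sgraph) (x y : H) (xy : sedge x y) : middle H :=
  inr (exist _ [set x; y] (edges_pair xy)).

(** The vertices of [H] that an element of the middle graph dominates. *)
Definition ends (H : sgraph) (z : middle H) : {set H} :=
  match z with inl v => [set v] | inr e => val e end.

Lemma card_ends (H : sgraph) (z : middle H) : #|ends z| <= 2.
Proof.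
case: z => [v|[e eH]] /=; first by rewrite cards1.
by have /edgesP[x [y [_ ->]]] := eH; rewrite cards2; case: (x != y).
Qed.

Definition kept (H : sgraph) (A : {set H}) (z : H) (zA : z \in A) : induced A :=
  exist _ z zA.

(** Two elements with a common end are equal or adjacent: this turns both
    domination and connectivity in a middle graph into statements about ends. *)
Lemma middle_meet (H : sgraph) (a b : middle H) (v : H) :
  v \in ends a -> v \in ends b -> (b == a) || sedge a b.
Proof.
case: a b => [x|e] [y|f] /=; rewrite ?inE.
- by move=> /eqP <- /eqP <-; rewrite eqxx.
- by move=> /eqP <-.
- by move=> ve /eqP <-.
move=> ve vf; have [->|nef] := eqVneq e f; first by rewrite eqxx.
by apply/orP; right; apply/andP; split=> //; apply/set0Pn; exists v; rewrite inE ve.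
Qed.

Lemma ends_neq0 (H : sgraph) (z : middle H) : exists v, v \in ends z.
Proof.
case: z => [v|[e eH]] /=; first by exists v; rewrite set11.
by have /edgesP[x [y [_ ->]]] := eH; exists x; rewrite set21.
Qed.

Lemma dominating_middle (H : sgraph) (S : {set middle H}) :
  (forall v : H, exists2 z, z \in S & v \in ends z) -> dominating S.
Proof.
move=> cov; apply/forallP => a; have [v va] := ends_neq0 a.
have [z zS vz] := cov v; apply/set0Pn; exists z; rewrite !inE zS andbT.
exact: middle_meet va vz.
Qed.

Lemma dominating_middle_cover (H : sgraph) (S : {set middle H}) (v : H) :
  dominating S -> exists2 z, z \in S & v \in ends z.
Proof.
move=> /forallP /(_ (inl v)) /set0Pn[z]; rewrite !inE => /andP[zv zS].
exists z => //; case: z zv {zS} => [x|e] /=; last by [].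
by rewrite orbF => /eqP[->]; rewrite set11.
Qed.

Lemma card_le_dominating_middle (H : sgraph) (S : {set middle H}) :
  dominating S -> #|H| <= #|S|.*2.
Proof.
move=> domS; have sub : [set: H] \subset \bigcup_(z in S) ends z.
  apply/subsetP => v _; have [z zS vz] := dominating_middle_cover v domS.
  by apply/bigcupP; exists z.
rewrite -cardsT (leq_trans (subset_leq_card sub)) //.
rewrite -muln2 -sum_nat_const.
elim/big_rec2: _ => [|z m B _ le_m]; first by rewrite cards0.
by apply: leq_trans (leq_card_setU _ _) _; apply: leq_add (card_ends z) _.
Qed.

(** Walking in [G] moves from one surviving edge to the next: if [h] sends the
    edges of [G] to pairs of ends of surviving elements, then two surviving
    elements are linked as soon as they have ends [h x] and [h y] with [x] and
    [y] linked in [G].  The vertices [h x] may well have been deleted,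
    since consecutive edges are adjacent to each other directly. *)
Lemma connect_middle_edges (G H : sgraph) (h : G -> H) (A : {set middle H}) :
    (forall x y : G, sedge x y ->
       exists2 z, z \in A & (h x \in ends z) && (h y \in ends z)) ->
  forall (x y : G) (a b : induced A), connect sedge x y ->
    h x \in ends (val a) -> h y \in ends (val b) ->
  connect (sedge : rel (induced A)) a b.
Proof.
move=> keep x y a b /connectP[s]; elim: s x a => [|x' s IHs] x a /=.
  move=> _ -> xa xb; have := middle_meet xa xb.
  by case/orP=> [/eqP/val_inj-> // | ab]; apply: connect1.
move=> /andP[xx' path_s] y_last xa yb; have [z zA /andP[xz x'z]] := keep _ _ xx'.
pose c := kept zA.
apply: connect_trans (IHs _ c path_s y_last x'z yb).
have := middle_meet xa (xz : h x \in ends (val c)).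
by case/orP=> [/eqP/val_inj-> // | ac]; apply: connect1.
Qed.

(** * The dominating set in the middle graph of the join *)

(** Enumerate [T]: the elements of rank below [p] already reach everything in
    ['I_p], so the element of rank [p] can serve as [v0]. *)
Lemma surjection_avoiding (T : finType) (p : nat) :
  0 < p < #|T| ->
  exists (v0 : T) (f : T -> 'I_p), forall i, exists2 v, v != v0 & f v = i.
Proof.
case: p => // p /= p_lt.
exists (enum_val (Ordinal p_lt)), (fun v => inord (enum_rank v)) => i.
have i_lt : i < #|T| by apply: ltn_trans (ltn_ord i) p_lt.
exists (enum_val (Ordinal i_lt)); last by rewrite enum_valK inord_val.
rewrite (inj_eq enum_val_inj); apply/eqP => -[i_eq].
by have := ltn_ord i; rewrite i_eq ltnn.
Qed.

Section JoinEdgeless.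
Variables (G : sgraph) (p : nat) (v0 : G) (f : G -> 'I_p).
Let H := join G (edgeless p).

Definition cross_edge (v : G) (i : 'I_p) : middle H :=
  @middle_edge H (inl v) (inr i) isT.

Definition chosen (v : G) : middle H :=
  if v == v0 then inl (inl v0) else cross_edge v (f v).

Definition chosen_set : {set middle H} := [set chosen v | v in G].

Lemma card_chosen_set : #|chosen_set| <= #|G|.
Proof. exact: leq_imset_card. Qed.

Lemma dominating_chosen_set :
  (forall i, exists2 v, v != v0 & f v = i) -> dominating chosen_set.
Proof.
move=> f_surj; apply: dominating_middle => -[v|i].
  exists (chosen v); first exact: imset_f.
  by rewrite /chosen; case: eqP => [->|_] /=; rewrite ?set11 ?set21.
have [v nv <-] := f_surj i; exists (chosen v); first exact: imset_f.
by rewrite /chosen (negPf nv) /= set22.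
Qed.

Lemma inner_edge_kept (x y : G) (xy : sedge (inl x : H) (inl y)) :
  middle_edge xy \notin chosen_set.
Proof.
apply/imsetP=> -[v _]; rewrite /chosen; case: eqP => // _ [] /setP/(_ (inr (f v))).
by rewrite !inE eqxx orbT.
Qed.

Lemma cross_edge_kept (i : 'I_p) : cross_edge v0 i \notin chosen_set.
Proof.
apply/imsetP=> -[v _]; rewrite /chosen; case: eqP => // nv [] /setP/(_ (inl v0)).
by rewrite !inE eqxx /= => /esym/orP[] // /eqP[v0v]; apply: nv.
Qed.

Lemma edge_inner_end (e : {e : {set H} | e \in edges H}) :
  exists x : G, (inl x : H) \in val e.
Proof.
case: e => e eH; have /edgesP[x [y [xy e_xy]]] := eH; rewrite /= e_xy.
case: x y xy {e_xy} => [x|i] [y|j] //= _.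
- by exists x; rewrite set21.
- by exists x; rewrite set21.
- by exists y; rewrite set22.
Qed.

Lemma connected_minus_chosen_set :
  connected_graph G -> 0 < p -> connected_graph (induced (~: chosen_set)).
Proof.
move=> G_conn p_gt0; pose A := ~: chosen_set.
have hubA : cross_edge v0 (Ordinal p_gt0) \in A by rewrite inE cross_edge_kept.
apply/andP; split; first by apply/card_gt0P; exists (kept hubA).
have keep (x y : G) : sedge x y ->
    exists2 z, z \in A & (inl x \in ends z) && (inl y \in ends z).
  move=> xy; exists (@middle_edge H (inl x) (inl y) xy).
    by rewrite inE inner_edge_kept.
  by rewrite /= set21 set22.
(* An added vertex has no end in G, so it is replaced by its edge to v0. *)
have reach (a : induced A) : exists (x : G) (b : induced A),
    [/\ inl x \in ends (val b), connect sedge a b & connect sedge b a].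
  case: a => -[[x|i]|e] aA.
  - by exists x, (kept aA); split=> //=; rewrite set11.
  - have bA : cross_edge v0 i \in A by rewrite inE cross_edge_kept.
    exists v0, (kept bA); split; first by rewrite /= set21.
      by apply: connect1; rewrite /= /induced_rel /= set22.
    by apply: connect1; rewrite /= /induced_rel /= set22.
  - have [x xe] := edge_inner_end e.
    by exists x, (kept aA).
apply/forallP => a; apply/forallP => b.
have [x [a' [xa aa' _]]] := reach a; have [y [b' [yb _ b'b]]] := reach b.
apply: connect_trans aa' (connect_trans _ b'b).
apply: (connect_middle_edges keep _ xa yb).
by case/andP: G_conn => _ /forallP/(_ x)/forallP/(_ y).
Qed.

End JoinEdgeless.

Theorem theorem5p7 (G : sgraph) (n p : nat) (G_conn : connected_graph G)
    (G_order : #|G| = n) (n_ge2 : 2 <= n) (p_ge1 : 1 <= p) (p_lt_n : p < n) :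
  uphalf (n + p) <= oc_dom_number (middle (join G (edgeless p))) <= n.
Proof.
subst n.
have [|v0 [f f_surj]] := @surjection_avoiding G p; first by rewrite p_ge1.
have ocS : oc_dominating (chosen_set v0 f).
  by rewrite /oc_dominating dominating_chosen_set // connected_minus_chosen_set.
apply/andP; split; last first.
  exact: leq_trans (oc_dom_number_min ocS) (card_chosen_set _ _).
have [S /andP[domS _] <-] := oc_dom_number_attained ocS.
rewrite leq_uphalf_double; apply: leq_trans (card_le_dominating_middle domS).
by rewrite card_sum card_ord.
Qed.
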